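(* Let $\mathcal K\subseteq\mathscr P_\sim(\mathbb U)$ be given. Then the following conditions are equivalent: (i) The set $\mathcal K$ is $W_H$-precompact (or, equivalently, the set $\Phi^{-1}(\mathcal K)$ is $\mathsf d_{\rm mG}$-precompact). (ii) Given any $\varepsilon>0$, there exist $N\in\mathbb N$ and points $x_1,\ldots,x_N\in\mathbb U$ with ${\rm diam}\{x_1,\ldots,x_N\}\leq N$ having the property that for any $\theta\in\mathcal K$ there exists $\mu\in\theta$ such that $\mu\big(\bigcup_{i=1}^N B_\varepsilon(x_i)\big)>1-\varepsilon$. (iii) Given any $\varepsilon>0$, there exists $N\in\mathbb N$ such that for any $\mu\in\mathscr P(\mathbb U)$ with $[\mu]\in\mathcal K$ there exist points $x^\mu_1,\ldots,x^\mu_N\in{\rm spt}(\mu)$ such that $\mu\big(\bigcup_{i=1}^N B_\varepsilon(x^\mu_i)\big)>1-\varepsilon$ and ${\rm diam}\{x^\mu_1,\ldots,x^\mu_N\}\leq N$.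
   Context: ''Isometry'' means distance-preserving map (not necessarily surjective). $(\mathbb U,\mathsf d_{\mathbb U})$ is the Urysohn universal metric space: the unique (up to isometric bijection) complete separable metric space that is universal (every separable metric space embeds isometrically in it) and ultrahomogeneous (every isometry $\phi\colon F\to\mathbb U$ on a finite subset $F\subseteq\mathbb U$ extends to an isometric bijection of $\mathbb U$). $B_r(x)$ denotes the open ball. Listed points $x_1,\dots,x_N$ need not be distinct. $\mathscr P(\mathbb U)$ is the set of Borel probability measures on $\mathbb U$; $W(\mu,\nu):=\inf_{\pi}\int\mathsf d_{\mathbb U}\wedge 1\,{\rm d}\pi$, the infimum being over all $\pi\in\mathscr P(\mathbb U\times\mathbb U)$ with marginals $\mu$ and $\nu$. For $\mu,\nu\in\mathscr P(\mathbb U)$, $\mu\sim\nu$ iff $\phi_\#\mu=\nu$ for some isometric bijection $\phi\colon{\rm spt}(\mu)\to{\rm spt}(\nu)$; $[\mu]$ is the $\sim$-class of $\mu$, $\mathscr P_\sim(\mathbb U):=\mathscr P(\mathbb U)/\sim$, and for $\theta,\eta\in\mathscr P_\sim(\mathbb U)$ $$W_H(\theta,\eta):=\max\Big\{\sup_{\mu\in\theta}\inf_{\nu\in\eta}W(\mu,\nu),\ \sup_{\nu\in\eta}\inf_{\mu\in\theta}W(\mu,\nu)\Big\}.$$ $(\mathscr P_\sim(\mathbb U),W_H)$ is a complete metric space; ''precompact'' means totally bounded (equivalently, with compact closure). A normalised metric measure space $({\rm X},\mathsf d,\mathfrak m)$ is a complete separable metric space with a Borel probability measure $\mathfrak m$;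 two of them are isomorphic if there is an isometric bijection $\phi\colon{\rm spt}(\mathfrak m_{\rm X})\to{\rm spt}(\mathfrak m_{\rm Y})$ with $\phi_\#\mathfrak m_{\rm X}=\mathfrak m_{\rm Y}$. $\mathbb X_1$ is the collection of isomorphism classes. The map $\Phi\colon\mathbb X_1\to\mathscr P_\sim(\mathbb U)$, $\Phi([{\rm X},\mathsf d,\mathfrak m]):=[f_\#\mathfrak m]$ for any isometry $f\colon{\rm X}\to\mathbb U$, is a well-defined bijection, and $\mathsf d_{\rm mG}(\mathcal X,\mathcal Y):=W_H(\Phi(\mathcal X),\Phi(\mathcal Y))$. *)

(* Defs.v *)
From HB Require Import structures.
From mathcomp Require Import all_boot all_order all_algebra.
From mathcomp Require Import all_classical all_reals all_analysis.

Set Implicit Arguments.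
Unset Strict Implicit.
Unset Printing Implicit Defensive.

Import Order.TTheory GRing.Theory Num.Theory.

Local Open Scope classical_set_scope.
Local Open Scope ring_scope.

(* Complete metric spaces.  [completeType] is pointed, hence these spaces are
   nonempty, as any space carrying a probability measure must be. *)
#[short(type="completeMetricType")]
HB.structure Definition CompleteMetric (R : numDomainType) :=
  {T of CompletePseudoMetric R T & Metric R T}.

Definition separable (T : topologicalType) :=
  exists2 D : set T, countable D & dense D.

(* Not necessarily surjective. *)
Definition isometry (R : numDomainType) (X Y : metricType R) (f : X -> Y) :=
  forall x y, mdist (f x) (f y) = mdist x y.

Definition isometry_on (R : numDomainType) (X Y : metricType R) (A : set X)
    (f : X -> Y) :=
  forall x y, A x -> A y -> mdist (f x) (f y) = mdist x y.

Record urysohn (R : realType) (U : completeMetricType R) : Prop := {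
  urysohn_separable : separable U ;
  urysohn_universal : forall M : metricType R, separable M ->
    exists f : M -> U, isometry f ;
  urysohn_ultrahomogeneous : forall (F : set U) (phi : U -> U),
    finite_set F -> isometry_on F phi ->
    exists psi : U -> U,
      [/\ isometry psi, bijective psi & {in F, psi =1 phi}] }.

(* As a supremum in [\bar R], the diameter of the empty set is [-oo]. *)
Definition diam (R : realType) (X : metricType R) (A : set X) : \bar R :=
  ereal_sup [set (mdist z.1 z.2)%:E | z in A `*` A].

#[warnings="-redundant-canonical-projection"]
HB.instance Definition _ (T T' : ptopologicalType) :=
  Pointed.on (T * T')%type.

Definition borel (T : ptopologicalType) := g_sigma_algebraType (@open T).

(* Two elements that agree on Borel sets may still differ as functions on
   [set T]; hence equality of measures is always tested on Borel sets below. *)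
Definition borel_prob (R : realType) (T : ptopologicalType) :=
  probability (borel T) R.

Definition spt (R : realType) (X : completeMetricType R)
    (mu : borel_prob R X) : set X :=
  [set x | forall r : R, 0 < r -> (0 < mu (ball x r))%E].

(* There is an isometric bijection from spt mu onto spt nu that pushes mu
   forward to nu.  The map is given by a total function, whose values outside
   spt mu are irrelevant. *)
Definition spt_iso (R : realType) (X Y : completeMetricType R)
    (mu : borel_prob R X) (nu : borel_prob R Y) :=
  exists phi : X -> Y,
    [/\ isometry_on (spt mu) phi,
        set_bij (spt mu) (spt nu) phi &
        forall A : set (borel Y), measurable A ->
          mu (spt mu `&` phi @^-1` A) = nu A].

Definition quotient_by (T : Type) (r : T -> T -> Prop) :=
  {C : set T | exists x, C = r x}.

Definition class_of (T : Type) (r : T -> T -> Prop) (x : T) : quotient_by r :=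
  exist _ (r x) (ex_intro _ x erefl).

Definition representative (T : Type) (r : T -> T -> Prop)
    (C : quotient_by r) : T :=
  projT1 (cid (svalP C)).

Definition prob_sim (R : realType) (U : completeMetricType R) :=
  quotient_by (@spt_iso R U U).

Definition prob_class (R : realType) (U : completeMetricType R)
    (mu : borel_prob R U) : prob_sim U :=
  class_of (@spt_iso R U U) mu.

Record nmm_space (R : realType) := {
  nmm_carrier : completeMetricType R ;
  nmm_separable : separable nmm_carrier ;
  nmm_measure : borel_prob R nmm_carrier }.

Definition nmm_iso (R : realType) (X Y : nmm_space R) :=
  spt_iso (nmm_measure X) (nmm_measure Y).

Definition nmm_class (R : realType) := quotient_by (@nmm_iso R).

Definition couplings (R : realType) (U : completeMetricType R)
    (mu nu : borel_prob R U) : set (borel_prob R (U * U)%type) :=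
  [set pi | forall A : set (borel U), measurable A ->
    pi (fst @^-1` A) = mu A /\ pi (snd @^-1` A) = nu A].

Definition W (R : realType) (U : completeMetricType R)
    (mu nu : borel_prob R U) : \bar R :=
  ereal_inf [set (\int[pi]_z (Num.min (mdist z.1 z.2) 1)%:E)%E
            | pi in couplings mu nu].

Definition W_H (R : realType) (U : completeMetricType R)
    (theta eta : prob_sim U) : \bar R :=
  Order.max
    (ereal_sup [set ereal_inf [set W mu nu | nu in sval eta]
               | mu in sval theta])
    (ereal_sup [set ereal_inf [set W mu nu | mu in sval theta]
               | nu in sval eta]).

Lemma isometry_measurable (R : realType) (X Y : completeMetricType R)
  (f : X -> Y) : isometry f ->
  measurable_fun [set: borel X] (f : borel X -> borel Y).
Proof.
move=> isof.
have cf : continuous f.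
  move=> x; apply/metricType_numDomainType.cvgrPdist_lt => e e0.
  near=> y; rewrite isof; near: y.
  exact: (@metricType_numDomainType.cvgr_dist_lt _ _ _ (nbhs x) _ id).
apply: (@measurability _ _ (borel X) (borel Y) setT f (@open Y) erefl).
move=> _ [B oB <-]; rewrite setTI; apply: sub_sigma_algebra.
by move/continuousP : cf; exact.
Unshelve. all: by end_near. Qed.

Section isometry_pushforward.
Context (R : realType) (X Y : completeMetricType R) (f : X -> Y).
Hypothesis isof : isometry f.

Let g : borel X -> borel Y := f.
HB.instance Definition _ :=
  isMeasurableFun.Build _ _ (borel X) (borel Y) g (isometry_measurable isof).

Definition isometry_pushforward (mu : borel_prob R X) : borel_prob R Y :=
  distribution mu g.

End isometry_pushforward.

(* The class does not depend on the representative nor on the isometry. *)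
Definition Phi (R : realType) (U : completeMetricType R) (hU : urysohn U)
    (C : nmm_class R) : prob_sim U :=
  let X := representative C in
  let f := cid (urysohn_universal hU (@nmm_separable R X)) in
  prob_class (isometry_pushforward (projT2 f) (nmm_measure X)).

Definition d_mG (R : realType) (U : completeMetricType R) (hU : urysohn U)
    (C D : nmm_class R) : \bar R :=
  W_H (Phi hU C) (Phi hU D).

Definition totally_bounded (R : realType) (T : Type) (d : T -> T -> \bar R)
    (K : set T) :=
  forall e : R, 0 < e -> exists2 F : set T, finite_set F &
    K `<=` \bigcup_(y in F) [set x | (d y x < e%:E)%E].

(* Main.v *)
Require Import Defs.
From HB Require Import structures.
From mathcomp Require Import all_boot all_order all_algebra.
From mathcomp Require Import all_classical all_reals all_analysis.
From mathcomp Require Import measurable_realfun lra.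
(* Imported again because MathComp has its own [isometry]. *)
Require Import Defs.

Set Implicit Arguments.
Unset Strict Implicit.
Unset Printing Implicit Defensive.

Import Order.TTheory GRing.Theory Num.Theory.

Local Open Scope classical_set_scope.
Local Open Scope ring_scope.

(* Phi is onto, because (U, mu) is itself a metric measure space; this
   settles (i) for both metrics. If theta is W_H-close to a member of a
   finite net, then some nu in theta is W-close to a chosen representative
   of that member, and Markov's inequality on a coupling carries a finite
   cover of almost all of the mass over to nu. Moving the points of such a
   cover into the support and transporting them along isomorphisms of
   supports yields (iii).

   From (iii) back to (i): round the mutual distances of the points x_i and,
   downwards, the masses of the balls made disjoint. Finitely many patterns
   occur. For each of them pick one measure showing the pattern, and take as
   net point the class of the measure with the rounded masses at its points
   x_i. If the points of two measures have almost the same mutual distances,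
   two copies of U can be glued so that these points nearly coincide;
   universality and ultrahomogeneity turn this into an isometry of U into U
   that carries one tuple close to the other. The coupling of a measure with
   a discrete one is then explicit, so that neither gluing of couplings nor
   the triangle inequality of W is needed. *)

(** * Supports and isomorphisms of supports *)

Section metric_space.
Context (R : realType) (X : metricType R).
Implicit Types (x y : X) (r : R).

Lemma ballP x r y : ball x r y <-> mdist x y < r.
Proof. by rewrite ballEmdist. Qed.

Lemma mdist_open (A : set X) :
  (forall x, A x -> exists2 r, 0 < r & forall y, mdist x y < r -> A y) ->
  open A.
Proof.
move=> hA; rewrite openE => x /hA[r r0 rA].
by apply/nbhs_ballP; exists r => //= y /ballP/rA.
Qed.

Lemma open_mdist (A : set X) x : open A -> A x ->
  exists2 r, 0 < r & forall y, mdist x y < r -> A y.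
Proof.
rewrite openE => oA /oA /nbhs_ballP[r /= r0 rA].
by exists r => // y ?; apply/rA/ballP.
Qed.

Lemma mball_open x r : open (ball x r).
Proof.
apply: mdist_open => y /ballP xy; exists (r - mdist x y); first by lra.
by move=> z yz; apply/ballP; have := metric_triangle x y z; lra.
Qed.

Lemma mball_sub x y r t : mdist x y + t <= r -> ball y t `<=` ball x r.
Proof.
move=> xyr z /ballP yz; apply/ballP.
by have := metric_triangle x y z; lra.
Qed.

End metric_space.

Lemma dense_sequence (R : realType) (X : completeMetricType R) : separable X ->
  exists s : nat -> X, forall x r, 0 < r -> exists n, mdist (s n) x < r.
Proof.
move=> [D /countable_injP[f finj] dD].
(* The injection [f] is inverted by choice. An index outside its range yields the default [point],
   which does no harm to density. *)
exists (fun n => xget point [set x | D x /\ f x = n]) => x r r0.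
have [||y [/ballP xy Dy]] := dD (ball x r); last 2 first.
- exact: mball_open.
- exists (f y); case: xgetP => [z _ [Dz fz]|/(_ y)]; last by case.
  by rewrite (finj z y) ?inE// metric_sym.
by exists x; apply/ballP; rewrite mdistxx.
Qed.

Lemma open_borel (X : ptopologicalType) (A : set X) :
  open A -> measurable (A : set (borel X)).
Proof. exact: sub_sigma_algebra. Qed.

Section support.
Context (R : realType) (X : completeMetricType R).
Implicit Types mu : borel_prob R X.


Lemma closed_borel (A : set X) : closed A -> measurable (A : set (borel X)).
Proof.
move=> cA; rewrite -[A]setCK; apply: measurableC; apply: open_borel.
exact: closed_openC.
Qed.

Lemma mball_borel (x : X) r : measurable (ball x r : set (borel X)).
Proof. by apply: open_borel; exact: mball_open. Qed.

Lemma bigcup_mball_borel (I : Type) (D : set I) (x : I -> X) r :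
  measurable (\bigcup_(i in D) ball (x i) r : set (borel X)).
Proof. by apply: open_borel; apply: bigcup_open => i _; exact: mball_open. Qed.

Lemma spt_closed mu : closed (spt mu).
Proof.
rewrite -[spt mu]setCK; apply: open_closedC; apply: mdist_open => x.
move=> /existsNP[r /not_implyP[r0 /negP]].
rewrite -leNgt => xr; exists r => // y xy ysp.
have ry0 : 0 < r - mdist x y by lra.
have := ysp _ ry0; apply/negP; rewrite -leNgt (le_trans _ xr)//.
apply: le_measure; rewrite ?inE//; try exact: mball_borel.
move=> z /ballP yz; apply/ballP.
by have := metric_triangle x y z; lra.
Qed.

Lemma spt_borel mu : measurable (spt mu : set (borel X)).
Proof. by apply: closed_borel; exact: spt_closed. Qed.

(** The Lindelof property made explicit: a point outside the support has a null ball, and inside it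
    a smaller null ball around the point whose centre [s n] lies in the dense sequence and whose
    radius is [1 / (m + 1)]. There are only countably many balls of this kind. *)
Lemma spt_setC mu : separable X -> mu (~` spt mu) = 0%E.
Proof.
move=> /dense_sequence[s hs].
suff /negligibleP : mu.-negligible (~` spt mu : set (borel X)).
  by apply; apply: measurableC; exact: spt_borel.
pose B n m : set (borel X) := if mu (ball (s n) m.+1%:R^-1) == 0%E
  then ball (s n) m.+1%:R^-1 else set0.
have sub : ~` spt mu `<=` (\bigcup_n \bigcup_m B n m : set X).
  move=> x /existsNP[r /not_implyP[r0 /negP]]; rewrite -leNgt => xr.
  pose m := Num.truncn (2 / r).
  have hm : m.+1%:R^-1 < r / 2.
    rewrite -[X in _ < X]invrK ltf_pV2 ?posrE ?invr_gt0 ?divr_gt0// invf_div.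
    exact: truncnS_gt.
  have [n hn] := hs x m.+1%:R^-1 ltac:(by rewrite invr_gt0).
  exists n => //; exists m => //; rewrite /B ifT; first exact/ballP.
  rewrite -measure_le0 (le_trans _ xr)//.
  apply: le_measure; rewrite ?inE//; try exact: mball_borel.
  apply: mball_sub; rewrite metric_sym [leRHS]splitr.
  by rewrite lerD ?ltW// (lt_trans hn).
apply: (@negligibleS _ _ _ mu _ _ sub).
apply: negligible_bigcup => n; apply: negligible_bigcup => m.
rewrite /B; case: ifPn => [/eqP h|_]; last exact: negligible_set0.
by exists (ball (s n) m.+1%:R^-1); split => //; exact: mball_borel.
Qed.

Lemma spt_full mu (A : set (borel X)) : separable X -> measurable A ->
  mu (spt mu `&` A) = mu A.
Proof.
move=> sX mA; rewrite [RHS](@measureDI _ _ _ mu A (spt mu))//; last first.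
  exact: spt_borel.
rewrite [X in (X + _)%E](_ : _ = 0%E) ?add0e 1?setIC//.
apply: (@subset_measure0 _ _ _ mu _ (~` spt mu)); last exact: spt_setC.
- by apply: measurableD => //; exact: spt_borel.
- by apply: measurableC; exact: spt_borel.
- by move=> x [].
Qed.

End support.

Section isometry_measurability.
Context (R : realType) (X Y : completeMetricType R).

Lemma isometry_on_borel (S : set X) (f : X -> Y) (A : set (borel Y)) :
  closed S -> isometry_on S f -> measurable A ->
  measurable (S `&` f @^-1` A : set (borel X)).
Proof.
move=> cS isof mA; have mS := closed_borel cS.
suff : measurable_fun (S : set (borel X)) (f : borel X -> borel Y) by apply.
apply: (@measurability _ _ (borel X) (borel Y) S f (@open Y) erefl).
move=> _ [B oB <-].
(* An open set of [X] whose trace on [S] is the preimage of [B]. As [f] is controlled only on [S],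
   every ball in the union is centred at a point of [S]. *)
pose O := [set y : X | exists x r, [/\ S x, mdist x y < r &
  forall z, mdist (f x) z < r -> B z]].
rewrite [X in measurable X](_ : _ = S `&` O).
  apply: measurableI => //; apply: open_borel; apply: mdist_open.
  move=> y [x [r [Sx xy xr]]]; exists (r - mdist x y); first by lra.
  move=> z yz; exists x, r; split => //.
  by have := metric_triangle x y z; lra.
apply/seteqP; split => y [Sy].
  move=> /(open_mdist oB)[r r0 rB]; split => //; exists y, r.
  by rewrite mdistxx.
by move=> [x [r [Sx xy xr]]]; split => //; apply: xr; rewrite isof.
Qed.

End isometry_measurability.

Section spt_iso_equivalence.
Context (R : realType).

Lemma spt_iso_refl (X : completeMetricType R) (mu : borel_prob R X) :
  separable X -> spt_iso mu mu.
Proof.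
move=> sX; exists id; split => //; last first.
  by move=> A mA; rewrite preimage_id spt_full.
by split => //; move=> x mx; exists x.
Qed.

Lemma spt_iso_sym (X Y : completeMetricType R) (mu : borel_prob R X)
    (nu : borel_prob R Y) : separable X -> spt_iso mu nu -> spt_iso nu mu.
Proof.
move=> sX [phi [iphi [fphi injphi surjphi] muphi]].
pose psi y := xget point [set x | spt mu x /\ phi x = y].
have psiP y : spt nu y -> spt mu (psi y) /\ phi (psi y) = y.
  move=> /surjphi[x mux xy]; rewrite /psi; case: xgetP => [z _ //|/(_ x)].
  by case.
have psiK x : spt mu x -> psi (phi x) = x.
  move=> mux; have [/= h1 h2] := psiP _ (fphi _ mux).
  by apply: injphi; rewrite ?inE.
have ipsi : isometry_on (spt nu) psi.
  move=> y z /psiP[my yE] /psiP[mz zE].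
  by rewrite -iphi// yE zE.
exists psi; split => //.
  split.
  - by move=> y /psiP[].
  - by move=> y z; rewrite !inE => /psiP[_ {2}<-] /psiP[_ {2}<-] ->.
  - by move=> x mux; exists (phi x); [exact: fphi|exact: psiK].
move=> A mA; rewrite -muphi; last first.
  by apply: isometry_on_borel => //; exact: spt_closed.
rewrite -[RHS]spt_full//; congr (mu _); apply/seteqP; split => x /= [mux].
  by move=> [_]; rewrite psiK.
by move=> Ax; split => //; split; [exact: fphi|rewrite psiK].
Qed.

Lemma spt_iso_trans (X Y Z : completeMetricType R) (mu : borel_prob R X)
    (nu : borel_prob R Y) (rho : borel_prob R Z) :
  spt_iso mu nu -> spt_iso nu rho -> spt_iso mu rho.
Proof.
move=> [phi [iphi bphi muphi]] [psi [ipsi bpsi nupsi]].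
have fphi : forall x, spt mu x -> spt nu (phi x) by case: bphi.
exists (psi \o phi); split.
- by move=> x y mx my; rewrite /= ipsi ?iphi//; exact: fphi.
- case: bphi => _ ij1 sj1; case: bpsi => f2 ij2 sj2; split.
  + by move=> x /fphi /f2.
  + move=> x y; rewrite !inE => mx my /ij2 xy.
    by apply: ij1; rewrite ?inE//; apply: xy; rewrite inE; exact: fphi.
  + by move=> z /sj2[y /sj1[x mx <-] <-]; exists x.
- move=> A mA; rewrite -nupsi// -muphi; last first.
    by apply: isometry_on_borel => //; exact: spt_closed.
  congr (mu _); apply/seteqP; split => x /= [mx].
    by move=> ?; split => //; split => //; exact: fphi.
  by move=> [].
Qed.

End spt_iso_equivalence.

(** * Push-forward by an isometry and surjectivity of Phi *)

Section pushforward_by_isometry.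
Context (R : realType) (X Y : completeMetricType R) (f : X -> Y).
Hypothesis isof : isometry f.

Lemma isometry_ball x r : f @^-1` ball (f x) r = ball x r.
Proof.
by apply/seteqP; split => y /= /ballP; rewrite ?isof => ?; apply/ballP;
  rewrite ?isof.
Qed.

Lemma isometry_borel (A : set (borel Y)) :
  measurable A -> measurable (f @^-1` A : set (borel X)).
Proof.
by move=> mA; rewrite -[X in measurable X]setTI; exact: isometry_measurable.
Qed.

Lemma isometry_inj : injective f.
Proof.
by move=> x y xy; apply/(@mdist_positivity R); rewrite -isof xy mdistxx.
Qed.

(** Surjectivity onto the support of the image is where completeness of [X] enters: a point [y] of
    that support is a limit of images of points of [spt mu], and since [f] is an isometry these
    points form a Cauchy filter. *)
Lemma spt_iso_pushforward (mu : borel_prob R X) : separable X ->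
  spt_iso mu (isometry_pushforward isof mu).
Proof.
move=> sX; set nu := isometry_pushforward isof mu.
have nuE A : nu A = mu (f @^-1` A) by [].
have near_spt y r : spt nu y -> 0 < r ->
    spt mu `&` f @^-1` ball y r !=set0.
  move=> ny r0; apply/set0P/eqP => h.
  have := ny _ r0; rewrite nuE -spt_full//; last first.
    by apply: isometry_borel; exact: mball_borel.
  by rewrite h measure0 ltxx.
exists f; split.
- by move=> x y _ _; exact: isof.
- split.
  + by move=> x mx r r0; rewrite nuE isometry_ball mx.
  + by move=> x y _ _; exact: isometry_inj.
  + move=> y ny.
    pose F : set_system X := filter_from [set r : R | 0 < r]
      (fun r => spt mu `&` f @^-1` ball y r).
    have PF : ProperFilter F.
      apply: filter_from_proper; last by move=> r; exact: near_spt.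
      apply: filter_from_filter; first by exists 1 => /=.
      move=> r t /= r0 t0; exists (Num.min r t); first by rewrite /= lt_min r0.
      move=> x /= [mx /ballP]; rewrite lt_min => /andP[xr xt].
      by split; split => //; apply/ballP.
    have /cauchy_cvg/cvg_ex[x Fx] : cauchy F.
      apply/cauchy_ballP => e e0; exists (spt mu `&` f @^-1` ball y (e / 2),
          spt mu `&` f @^-1` ball y (e / 2)).
        by split; exists (e / 2) => //=; rewrite divr_gt0.
      move=> [a b] /= [[_ /ballP ya] [_ /ballP yb]]; apply/ballP.
      rewrite -isof; have := metric_triangle (f a) y (f b).
      by rewrite (metric_sym (f a) y); lra.
    (* The point [z] serves twice: it shows that [x] lies in [spt mu] and that [f x = y]. *)
    have near_x r : 0 < r ->
        exists z, [/\ spt mu z, mdist x z < r & mdist y (f z) < r].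
      move=> r0; have [t /= t0 tr] := Fx _ (nbhsx_ballx x r r0).
      have [|z [mz /ballP]] := near_spt y (Num.min r t) ny.
        by rewrite lt_min r0.
      rewrite lt_min => /andP[zr zt]; exists z; split => //.
      by apply/ballP/tr; split => //; apply/ballP.
    exists x.
      move=> r r0; have r20 : 0 < r / 2 by lra.
      have [z [mz xz _]] := near_x _ r20.
      rewrite (lt_le_trans (mz _ r20))//.
      apply: le_measure; rewrite ?inE//; try exact: mball_borel.
      by apply: mball_sub; lra.
    apply/(@mdist_positivity R)/eqP; rewrite eq_le mdist_ge0 andbT.
    apply/ler_addgt0Pl => e e0; rewrite addr0.
    have e20 : 0 < e / 2 by lra.
    have [z [_ xz yz]] := near_x _ e20.
    have := metric_triangle (f x) (f z) y.
    by rewrite isof (metric_sym (f z)); lra.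
- by move=> A mA; rewrite nuE spt_full//; exact: isometry_borel.
Qed.

End pushforward_by_isometry.

Lemma representativeE (T : Type) (r : T -> T -> Prop) (C : quotient_by r) :
  sval C = r (representative C).
Proof. by rewrite /representative; case: cid. Qed.

Section prob_sim_theory.
Context (R : realType) (U : completeMetricType R).
Hypothesis sU : separable U.

Lemma prob_class_eq (mu nu : borel_prob R U) :
  spt_iso mu nu -> prob_class mu = prob_class nu.
Proof.
move=> mn; apply: eq_sig_hprop => [? ? ?|/=]; first exact: Prop_irrelevance.
apply/funext => rho; apply/propext; split; apply: spt_iso_trans => //.
exact: spt_iso_sym.
Qed.

(** [Phi] uses a chosen representative of the class of [(U, mu)], which is only isomorphic to it;
    the isomorphism is therefore composed with the one onto the push-forward. *)
Lemma Phi_surjective (hU : urysohn U) (theta : prob_sim U) :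
  exists C, Phi hU C = theta.
Proof.
have [mu ->] : exists mu, theta = prob_class mu.
  by case: theta => C [mu E]; subst C; exists mu.
pose C := class_of (@nmm_iso R) (Build_nmm_space sU mu).
exists C; rewrite /Phi; set f := cid _; set X := representative C.
apply/esym/prob_class_eq.
have muX : spt_iso mu (nmm_measure X).
  have : sval C X.
    by rewrite representativeE; apply: spt_iso_refl; exact: nmm_separable.
  by [].
apply: spt_iso_trans muX _; apply: spt_iso_pushforward.
exact: nmm_separable.
Qed.

(** [d_mG] is [W_H] pulled back along [Phi], so [Phi] and a right inverse of it carry finite nets to
    finite nets of the same radius. *)
Lemma totally_bounded_Phi (hU : urysohn U) (K : set (prob_sim U)) :
  totally_bounded (@W_H R U) K <->
  totally_bounded (@d_mG R U hU) (Phi hU @^-1` K).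
Proof.
have [inv invK] : exists inv, forall theta, Phi hU (inv theta) = theta.
  have /choice[inv invK] : forall theta, exists C, Phi hU C = theta.
    by move=> theta; exact: Phi_surjective.
  by exists inv.
split=> tb e /tb[F finF KF].
  exists (inv @` F); first exact: finite_image.
  move=> C /KF[theta Ft tC]; exists (inv theta); first by exists theta.
  by rewrite /= /d_mG invK.
exists (Phi hU @` F); first exact: finite_image.
move=> theta Kt; have [|C FC Ct] := KF (inv theta); first by rewrite /= invK.
exists (Phi hU C); first by exists C.
by move: Ct; rewrite /= /d_mG invK.
Qed.

End prob_sim_theory.

(** * Transport cost *)

Section optimal_transport_cost.
Context (R : realType) (U : completeMetricType R).

Lemma open_mdist_lt (r : R) : open [set z : U * U | mdist z.1 z.2 < r].
Proof.
rewrite openE => -[x y] /= xy; pose e := (r - mdist x y) / 2.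
have e0 : 0 < e by rewrite /e; lra.
exists (ball x e, ball y e); first by split; exact: nbhsx_ballx.
move=> [a b] /= [/ballP xa /ballP yb].
have := metric_triangle a x b; have := metric_triangle x y b.
by rewrite (metric_sym a x) /e in xa yb *; lra.
Qed.

Lemma mdist_ge_borel (r : R) :
  measurable ([set z | r <= mdist z.1 z.2] : set (borel (U * U)%type)).
Proof.
rewrite (_ : [set z | _] = ~` [set z : U * U | mdist z.1 z.2 < r]).
  by apply: measurableC; apply: open_borel; exact: open_mdist_lt.
by apply/seteqP; split => z /=; rewrite leNgt => /negP.
Qed.

Lemma continuous_borel (X Y : ptopologicalType) (f : X -> Y) : continuous f ->
  measurable_fun setT (f : borel X -> borel Y).
Proof.
move=> /continuousP cf.
apply: (@measurability _ _ (borel X) (borel Y) setT f (@open Y) erefl).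
by move=> _ [B oB <-]; rewrite setTI; apply: sub_sigma_algebra; exact: cf.
Qed.

Let cost (z : borel (U * U)%type) : R := Num.min (mdist z.1 z.2) 1.

Lemma cost_ge0 z : 0 <= cost z.
Proof. by rewrite le_min mdist_ge0 ler01. Qed.

Lemma measurable_cost : measurable_fun setT cost.
Proof.
apply: (measurability _ (RGenInftyO.measurableE R)) => // _ [_ [r ->] <-].
rewrite setTI; have [r1|r1] := leP r 1.
  rewrite (_ : _ @^-1` _ = [set z : U * U | mdist z.1 z.2 < r]).
    by apply: open_borel; exact: open_mdist_lt.
  apply/seteqP; split => z; rewrite /cost /= in_itv/= gt_min (ltNge 1) r1/=.
    by rewrite orbF.
  by move=> ->.
rewrite (_ : _ @^-1` _ = setT)//.
apply/seteqP; split => // z _.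
by rewrite /cost /= in_itv/= gt_min r1 orbT.
Qed.

(** Markov's inequality for the truncated cost. Because of [r <= 1], the truncation does not affect
    whether the cost reaches [r]. *)
Lemma transport_markov (mu nu : borel_prob R U) (r s : R) : 0 < r <= 1 ->
  (W mu nu < (r * s)%:E)%E ->
  exists2 pi, couplings mu nu pi &
    (pi [set z | (r <= mdist z.1 z.2)%R] < s%:E)%E.
Proof.
move=> /andP[r0 r1] /ereal_inf_lt[_ [pi mnpi <-] lt_rs]; exists pi => //.
rewrite -(@lte_pmul2l _ r%:E)// -EFinM; apply: le_lt_trans lt_rs.
have h : (r%:E * pi (setT `&` [set z | r%:E <= `|(cost z)%:E|]) <=
    \int[pi]_z `|(cost z)%:E|)%E.
  apply: (@le_integral_comp_abse _ _ _ pi setT measurableT (EFin \o cost) r id).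
  - exact: measurable_id.
  - by [].
  - by [].
  - by apply/measurable_EFinP; exact: measurable_cost.
  - exact: r0.
rewrite (_ : [set z | _] = setT `&` [set z | (r%:E <= `|(cost z)%:E|)%E]).
  apply: le_trans h _; rewrite le_eqVlt; apply/orP; left; apply/eqP.
  by apply: eq_integral => z _; rewrite gee0_abs// lee_fin cost_ge0.
rewrite setTI; apply/seteqP; split => z /=.
  by rewrite lee_fin ger0_norm ?cost_ge0// le_min r1 andbT.
by rewrite lee_fin ger0_norm ?cost_ge0// le_min r1 andbT.
Qed.

(** Pointwise, the cost is at most [r] off the event and at most [1] on it. *)
Lemma transport_le (mu nu : borel_prob R U) pi (r s : R) : 0 <= r ->
  couplings mu nu pi -> (pi [set z | (r <= mdist z.1 z.2)%R] <= s%:E)%E ->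
  (W mu nu <= (r + s)%:E)%E.
Proof.
move=> r0 mnpi pis; apply: (@le_trans _ _ (\int[pi]_z (cost z)%:E)%E).
  by apply: ereal_inf_lbound; exists pi.
pose E : set (borel (U * U)%type) := [set z | r <= mdist z.1 z.2].
have mE : measurable E by exact: mdist_ge_borel.
apply: (@le_trans _ _ (\int[pi]_z (r%:E + (\1_E z)%:E))%E).
  apply: ge0_le_integral => //.
  - by move=> z _; rewrite lee_fin cost_ge0.
  - by apply/measurable_EFinP; exact: measurable_cost.
  - apply: emeasurable_funD => //.
    by apply/measurable_EFinP; exact: measurable_indic.
  - move=> z _; rewrite -EFinD lee_fin /cost indicE.
    have [zE|zE] := boolP (z \in E).
      by rewrite ge_min lerDr r0 orbT.
    rewrite addr0 ge_min ltW//.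
    by move: zE; rewrite notin_setE /E/= => /negP; rewrite -ltNge.
rewrite ge0_integralD//=.
- rewrite integral_cst// integral_indic// setIT.
  rewrite [X in (_ * X)%E](_ : _ = 1%E); last exact: probability_setT.
  by rewrite mule1 EFinD leeD2l.
- by apply/measurable_EFinP; exact: measurable_indic.
Qed.

(** Continuity from below along finite unions of balls around a dense sequence. *)
Lemma finite_cover (mu : borel_prob R U) (r e : R) : separable U ->
  0 < r -> 0 < e -> exists s : seq U,
  ((1 - e)%:E < mu (\bigcup_(x in [set` s]) ball x r))%E.
Proof.
move=> /dense_sequence[s hs] r0 e0.
pose F n : set (borel U) := \bigcup_(i in `I_n) ball (s i) r.
have mF n : measurable (F n).
  by apply: bigcup_measurable => i _; exact: mball_borel.
have UF : \bigcup_n F n = setT.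
  apply/seteqP; split => // x _; have [n hn] := hs x _ r0.
  by exists n.+1 => //; exists n => /=; [|apply/ballP].
have /nondecreasing_cvg_mu := mF.
rewrite UF => /(_ R mu measurableT).
have ndF : {homo F : n m / (n <= m)%N >-> (n <= m)%O}.
  move=> n m nm; apply/subsetPset => x [i /= ilt]; exists i => //=.
  exact: leq_trans nm.
move=> /(_ ndF) h.
have : nbhs (mu setT) [set x | ((1 - e)%:E < x)%E].
  rewrite probability_setT; apply: open_nbhs_nbhs; split.
    exact: open_ereal_gt_ereal.
  by rewrite /= lte_fin; lra.
move=> /h[n _ /(_ n (leqnn n))] /= hn.
exists [seq s i | i <- iota 0 n]; apply: lt_le_trans hn _.
apply: le_measure; rewrite ?inE//.
  exact: bigcup_mball_borel.
move=> x [i /= ilt xi]; exists (s i) => //=.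
by apply/map_f; rewrite mem_iota.
Qed.

End optimal_transport_cost.

(** * Finite combinations of measures *)

Section finite_mixture.
Context d (T : measurableType d) (R : realType).

Lemma finite_mixture (I : eqType) (s : seq I)
    (m : I -> {measure set T -> \bar R}) (c : I -> R) : (forall i, 0 <= c i) ->
  exists P : {measure set T -> \bar R},
    forall A, P A = (\sum_(i <- s) (c i)%:E * m i A)%E.
Proof.
move=> c0; elim: s => [|i s [P PE]].
  by exists mzero => A; rewrite big_nil.
exists (measure_add (mscale (NngNum (c0 i)) (m i)) P) => A.
by rewrite big_cons -PE [LHS]measure_addE.
Qed.

Lemma finite_mixture_prob (I : eqType) (s : seq I)
    (m : I -> {measure set T -> \bar R}) (c : I -> R) : (forall i, 0 <= c i) ->
  (\sum_(i <- s) (c i)%:E * m i setT = 1)%E ->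
  exists P : probability T R,
    forall A, P A = (\sum_(i <- s) (c i)%:E * m i A)%E.
Proof.
move=> c0 c1; have [P PE] := finite_mixture s m c0.
(* The total mass is already 1, so normalising only packages [P] as a probability. *)
exists (mnormalize P (dirac point)) => A.
rewrite -PE in c1 *; rewrite /= /mnormalize c1 onee_eq0/=.
by rewrite invr1 mule1.
Qed.

End finite_mixture.

(** * Coupling with a discrete measure *)

Lemma measure_partition d (T : measurableType d) (R : realType)
    (mu : probability T R) (I : finType) (A : I -> set T) (B : set T) :
  (forall i, measurable (A i)) -> trivIset setT A -> measurable B ->
  mu B = (mu (~` (\bigcup_i A i) `&` B) + \sum_i mu (A i `&` B))%E.
Proof.
move=> mA tA mB; have mUA : measurable (\bigcup_i A i).
  by apply: fin_bigcup_measurable => //; exact: finite_finset.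
rewrite (measureDI mu mB mUA) setDE setIC; congr (_ + _)%E.
rewrite setI_bigcupr measure_fin_bigcup//.
- rewrite (_ : setT = [set` index_enum I]).
    rewrite -fsbig_seq ?index_enum_uniq//.
    by apply: eq_bigr => i _; rewrite setIC.
  by apply/seteqP; split => // i _ /=; rewrite mem_index_enum.
- exact: finite_finset.
- exact: trivIset_setIl.
- by move=> i _; exact: measurableI.
Qed.

(** * The product of a Dirac mass at [z] with the restriction of [mu] to [A] *)

Section slice.
Context (R : realType) (U : completeMetricType R) (mu : borel_prob R U).
Context (A : set (borel U)) (mA : measurable A) (z : U).

Let pair_z : borel U -> borel (U * U)%type := fun u => (z, u).

Let measurable_pair_z : measurable_fun setT pair_z.
Proof.
apply: (@continuous_borel U (U * U)%type (fun u => (z, u))) => u.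
by apply: cvg_pair => //; exact: cvg_cst.
Qed.

(* The canonical measure on a pushforward takes the measurability proof as an
   argument that unification cannot find. *)
Definition slice : {measure set (borel (U * U)%type) -> \bar R} :=
  measure_function_pushforward__canonical__measure_function_Measure
    (mrestr mu mA) measurable_pair_z.

Lemma sliceE B : slice B = mu (A `&` [set u | B (z, u)]).
Proof. by rewrite setIC. Qed.

Lemma slice_borel (B : set (borel (U * U)%type)) : measurable B ->
  measurable ([set u | B (z, u)] : set (borel U)).
Proof.
by move=> mB; rewrite -[X in measurable X]setTI; exact: measurable_pair_z.
Qed.

End slice.

Section atomic.
Context (R : realType) (U : completeMetricType R) (I : finType).
Implicit Types (z : I -> U) (c : I -> R) (w : U).

(** A convex combination of Dirac masses. It is stated as a property, not as a construction, so that
    it can be passed on to push-forwards and isomorphic measures. *)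
Definition atomic (nu : borel_prob R U) z c w :=
  forall B : set (borel U), measurable B ->
    nu B = (\sum_i c i * \1_B (z i) + (1 - \sum_i c i) * \1_B w)%:E.

Lemma atomic_exists z c w : (forall i, 0 <= c i) -> \sum_i c i <= 1 ->
  exists nu, atomic nu z c w.
Proof.
move=> c0 c1.
pose s := None :: [seq Some i | i <- index_enum I].
pose m (o : option I) : {measure set (borel U) -> \bar R} :=
  if o is Some i then \d_(z i : borel U) else \d_(w : borel U).
pose c' (o : option I) := if o is Some i then c i else 1 - \sum_i c i.
have sumE (B : set (borel U)) : (\sum_(o <- s) (c' o)%:E * m o B =
    (\sum_i c i * \1_B (z i) + (1 - \sum_i c i) * \1_B w)%:E)%E.
  rewrite big_cons big_map addeC [RHS]EFinD -sumEFin /= diracE -indicE -EFinM.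
  by congr (_ + _)%E; apply: eq_bigr => i _; rewrite /= diracE.
have [| |nu nuE] := @finite_mixture_prob _ (borel U) R _ s m c'.
- by case=> //= ; rewrite subr_ge0.
- rewrite sumE indicT mulr1; under eq_bigr do rewrite mulr1.
  by rewrite addrC subrK.
- by exists nu => B _; rewrite nuE sumE.
Qed.

(* Each [A i] sends the share [c i] of its mass to [z i]; everything else is
   sent to [w]. *)
Lemma atomic_coupling (mu nu : borel_prob R U) (A : I -> set (borel U)) z c w
    (r : R) :
  (forall i, measurable (A i)) -> trivIset setT A ->
  (forall i, 0 <= c i) -> (forall i, ((c i)%:E <= mu (A i))%E) ->
  (forall i u, A i u -> mdist (z i) u < r) -> atomic nu z c w ->
  exists2 pi, couplings nu mu pi &
    (pi [set p | (r <= mdist p.1 p.2)%R] <= (1 - \sum_i c i)%:E)%E.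
Proof.
move=> mA tA c0 cA Ar nuE.
pose q (B : set (borel U)) := fine (mu B).
have qE B : measurable B -> mu B = (q B)%:E.
  by move=> mB; rewrite fineK// fin_num_measure.
pose A0 := ~` (\bigcup_i A i).
have mA0 : measurable A0.
  apply: measurableC; apply: fin_bigcup_measurable => [|i _]; last exact: mA.
  exact: finite_finset.
have qpart B : measurable B -> q B = q (A0 `&` B) + \sum_i q (A i `&` B).
  move=> mB; apply: EFin_inj; rewrite -qE// (measure_partition mu mA tA mB).
  rewrite EFinD -sumEFin qE; last exact: measurableI.
  by congr (_ + _)%E; apply: eq_bigr => i _; rewrite qE//; exact: measurableI.
have q1 : q A0 + \sum_i q (A i) = 1.
  rewrite -[RHS](_ : q setT = 1); last by rewrite /q probability_setT.
  rewrite [RHS]qpart// setIT; congr (_ + _).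
  by apply: eq_bigr => i _; rewrite setIT.
have q0 B : 0 <= q B by exact: fine_ge0.
have cq i : c i <= q (A i) by rewrite -lee_fin -qE.
(* The fraction of [A i] that is sent to [z i]. If [A i] is null, division yields 0, and [c i] is 0
   as well. *)
pose t i := c i / q (A i).
have tq i : t i * q (A i) = c i.
  rewrite /t; have [qA|qA] := eqVneq (q (A i)) 0; last by rewrite divfK.
  by rewrite qA mulr0; apply/eqP; rewrite eq_le c0 -qA cq.
have t0 i : 0 <= t i by rewrite divr_ge0.
have t1 i : t i <= 1.
  have := q0 (A i); rewrite le_eqVlt => /predU1P[qA|qA].
    by rewrite /t -qA invr0 mulr0.
  by rewrite ler_pdivrMr// mul1r.
(* [Some (i, true)] is the part of [A i] sent to [z i], [Some (i, false)] the part of [A i] sent to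
   [w], and [None] the mass outside all [A i], also sent to [w]. *)
pose s : seq (option (I * bool)) := None ::
  [seq Some (i, true) | i <- index_enum I] ++
  [seq Some (i, false) | i <- index_enum I].
pose m (o : option (I * bool)) : {measure set (borel (U * U)%type) -> \bar R} :=
  match o with
  | Some (i, b) => slice mu (mA i) (if b then z i else w)
  | None => slice mu mA0 w
  end.
pose c' (o : option (I * bool)) : R :=
  match o with
  | Some (i, b) => if b then t i else 1 - t i
  | None => 1
  end.
have sumE (B : set (borel (U * U)%type)) : measurable B ->
    (\sum_(o <- s) (c' o)%:E * m o B =
     (q (A0 `&` [set u | B (w, u)]) +
      (\sum_i t i * q (A i `&` [set u | B (z i, u)]) +
       \sum_i (1 - t i) * q (A i `&` [set u | B (w, u)])))%:E)%E.
  move=> mB; rewrite big_cons big_cat !big_map /= mul1e !EFinD -!sumEFin.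
  have mI (C : set (borel U)) v : measurable C ->
      measurable (C `&` [set u | B (v, u)]).
    by move=> mC; apply: measurableI => //; exact: slice_borel.
  rewrite sliceE qE; last exact: mI.
  congr (_ + (_ + _))%E; apply: eq_bigr => i _; rewrite sliceE qE ?EFinM//;
    exact: mI.
have restE : q A0 + \sum_i (1 - t i) * q (A i) = 1 - \sum_i c i.
  rewrite -[X in _ = X - _]q1 -addrA -sumrB; congr (_ + _).
  apply: eq_bigr => i _.
  by rewrite mulrBl mul1r tq.
have [| |pi piE] := @finite_mixture_prob _ (borel (U * U)%type) R _ s m c'.
- by case=> [[i []]|] //=; rewrite subr_ge0.
- rewrite sumE//= setIT.
  under eq_bigr do rewrite setIT tq.
  under [X in _ + (_ + X)]eq_bigr do rewrite setIT.
  by rewrite addrCA restE addrC subrK.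
exists pi.
  move=> B mB; have mB1 : measurable (fst @^-1` B : set (borel (U * U)%type)).
    rewrite -[X in measurable X]setTI.
    by apply: (@continuous_borel (U * U)%type U fst) => // p; exact: cvg_fst.
  have mB2 : measurable (snd @^-1` B : set (borel (U * U)%type)).
    rewrite -[X in measurable X]setTI.
    by apply: (@continuous_borel (U * U)%type U snd) => // p; exact: cvg_snd.
  split; rewrite piE sumE//; last first.
    rewrite qE// [in RHS]qpart//= -big_split/=; congr (_ + _)%:E.
    by apply: eq_bigr => i _; rewrite -mulrDl addrC subrK mul1r.
  have qI C (v : U) : q (C `&` [set u | (fst @^-1` B) (v, u)]) = q C * \1_B v.
    have [vB|vB] := boolP (v \in B).
      rewrite indicE vB mulr1 (_ : [set u | _] = setT) ?setIT//.
      by apply/seteqP; split => // u _ /=; move: vB; rewrite inE.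
    rewrite indicE (negbTE vB) mulr0 (_ : [set u | _] = set0).
      by rewrite setI0 /q measure0.
    by apply/seteqP; split => // u /=; move: vB; rewrite notin_setE.
  rewrite nuE// qI; under eq_bigr do rewrite qI mulrA tq.
  under [X in _ + (_ + X)]eq_bigr do rewrite qI mulrA.
  by rewrite -mulr_suml addrCA -mulrDl restE.
pose B : set (borel (U * U)%type) := [set p | r <= mdist p.1 p.2].
rewrite -[X in pi X]/B piE sumE; last exact: mdist_ge_borel.
rewrite lee_fin -restE.
have mB v : measurable ([set u | B (v, u)] : set (borel U)).
  by apply: slice_borel; exact: mdist_ge_borel.
have qI (C : set (borel U)) v :
    measurable C -> q (C `&` [set u | B (v, u)]) <= q C.
  move=> mC; rewrite -lee_fin -!qE//; last exact: measurableI.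
  by apply: le_measure; rewrite ?inE//; exact: measurableI.
(* The points of [A i] are closer than [r] to [z i], so only mass paired with [w] can lie at
   distance [r] or more. *)
rewrite lerD ?qI// [X in X + _]big1 ?add0r.
  by apply: ler_sum => i _; rewrite ler_wpM2l ?subr_ge0 ?qI.
move=> i _; rewrite (_ : _ `&` _ = set0) ?[q set0]/q ?measure0 ?mulr0//.
by apply/seteqP; split => // u [/Ar/= ur]; rewrite /B /= leNgt ur.
Qed.

End atomic.

(** * Aligning tuples in the Urysohn space *)

Section glued_space.
Context (R : realType) (U : completeMetricType R) (I : finType).
Implicit Types (u v : U).

(** The factor 2 is what gluing at distance [d] demands: a detour through the other copy crosses
    twice, at cost [2 * d]. *)
Definition almost_isometric (d : R) (x y : I -> U) :=
  forall k l, `|mdist (x k) (x l) - mdist (y k) (y l)| <= 2 * d.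

(* Two copies of U with x k on the left and y k on the right at distance d.  The
   proofs are parameters so that the metric structure can be inferred from the
   type. *)
Definition glued (k0 : I) (x y : I -> U) (d : R) (d0 : 0 < d)
  (xy : almost_isometric d x y) := (U + U)%type.

Section glued_metric.
Context (k0 : I) (x y : I -> U) (d : R) (d0 : 0 < d)
  (xy : almost_isometric d x y).

Let through u v k := mdist u (x k) + d + mdist (y k) v.

(** The index [k0] makes [I] nonempty, so that the minimum over the bridges from [x k] to [y k] is
    attained. *)
Definition cross_dist u v := through u v [arg min_(k < k0) through u v k]%O.

Lemma cross_dist_le u v k :
  cross_dist u v <= mdist u (x k) + d + mdist (y k) v.
Proof.
by rewrite /cross_dist; case: arg_minP => // i _; exact.
Qed.

Lemma cross_distP u v :
  exists k, cross_dist u v = mdist u (x k) + d + mdist (y k) v.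
Proof. by eexists. Qed.

Lemma cross_dist_gt0 u v : 0 < cross_dist u v.
Proof.
have [k ->] := cross_distP u v.
by have := d0; have := mdist_ge0 u (x k); have := mdist_ge0 (y k) v; lra.
Qed.

Definition glued_dist (a b : U + U) : R :=
  match a, b with
  | inl u, inl v | inr u, inr v => mdist u v
  | inl u, inr v | inr v, inl u => cross_dist u v
  end.

Lemma glued_distxx a : glued_dist a a = 0.
Proof. by case: a => u; exact: mdistxx. Qed.

Lemma glued_dist_eq0 a b : glued_dist a b = 0 -> a = b.
Proof.
case: a b => u [] v /=; try by move/mdist_positivity ->.
- by move=> uv; have := cross_dist_gt0 u v; rewrite uv ltxx.
- by move=> vu; have := cross_dist_gt0 v u; rewrite vu ltxx.
Qed.

Lemma glued_distC a b : glued_dist a b = glued_dist b a.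
Proof. by case: a b => u [] v //=; exact: metric_sym. Qed.

(** If the path changes copies once, the optimal bridge is kept. If it leaves a copy through bridge
    [k] and returns through bridge [l], almost isometry bounds the distance between their ends in
    one copy by that in the other plus [2 * d]. *)
Lemma glued_dist_triangle b a c :
  glued_dist a c <= glued_dist a b + glued_dist b c.
Proof.
case: a b c => u [] v [] w /=; try exact: metric_triangle.
- have [k ->] := cross_distP v w.
  have := cross_dist_le u w k; have := metric_triangle u v (x k); lra.
- have [k ->] := cross_distP u v; have [l ->] := cross_distP w v.
  have := metric_triangle (y k) v (y l).
  have := metric_triangle u (x k) w; have := metric_triangle (x k) (x l) w.
  have := xy k l; rewrite ler_norml => /andP[_].
  by rewrite (metric_sym v (y l)) (metric_sym w (x l)); lra.
- have [k ->] := cross_distP u v.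
  have := cross_dist_le u w k; have := metric_triangle (y k) v w; lra.
- have [k ->] := cross_distP v u.
  have := cross_dist_le w u k; have := metric_triangle w v (x k).
  rewrite (metric_sym w v); lra.
- have [k ->] := cross_distP v u; have [l ->] := cross_distP v w.
  have := metric_triangle (x k) v (x l).
  have := metric_triangle u (y k) w; have := metric_triangle (y k) (y l) w.
  have := xy k l; rewrite ler_norml => /andP[+ _].
  by rewrite (metric_sym u (y k)) (metric_sym (x k) v); lra.
- have [k ->] := cross_distP w v.
  have := cross_dist_le w u k; have := metric_triangle (y k) v u.
  rewrite (metric_sym u v); lra.
Qed.

End glued_metric.

HB.instance Definition _ k0 x y d d0 xy :=
  Choice.on (@glued k0 x y d d0 xy).

HB.instance Definition _ k0 x y d d0 xy :=
  isMetric.Build R (@glued k0 x y d d0 xy) (@glued_distxx k0 x y d)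
    (@glued_dist_eq0 k0 x y d d0) (@glued_distC k0 x y d)
    (@glued_dist_triangle k0 x y d xy).

Lemma glued_separable k0 x y d d0 xy : separable U ->
  separable (@glued k0 x y d d0 xy).
Proof.
move=> [D cD dD].
exists ((fun b : bool * U => if b.1 then inl b.2 else inr b.2) @`
    (setT `*` D)).
  by apply: sub_countable (card_image_le _ _) _; exact: countableX.
have meets u r : 0 < r -> exists2 v, D v & mdist u v < r.
  move=> r0; have [||v [/ballP uv Dv]] := dD (ball u r); last by exists v.
  - by exists u; apply/ballP; rewrite mdistxx.
  - exact: mball_open.
move=> O [[u|u] Ou] /open_mdist/(_ Ou)[r r0 rO].
  have [v Dv uv] := meets u r r0.
  by exists (inl v); split; [exact: rO|exists (true, v)].
have [v Dv uv] := meets u r r0.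
by exists (inr v); split; [exact: rO|exists (false, v)].
Qed.

(** Universality embeds the glued space into [U], and ultrahomogeneity moves the image of the tuple
    [x] in the left copy back to [x]. The right copy then gives [g]. *)
Lemma urysohn_align (hU : urysohn U) (k0 : I) (x y : I -> U) (d : R) :
  0 < d -> almost_isometric d x y ->
  exists2 g : U -> U, isometry g & forall i, mdist (g (y i)) (x i) <= d.
Proof.
move=> d0 xy.
have [f isof] := urysohn_universal hU
  (@glued_separable k0 _ _ _ d0 xy (urysohn_separable hU)).
pose fl (u : U) : U := f (inl u).
have isofl : isometry fl by move=> u v; rewrite /fl isof.
pose phi p := xget point [set u | fl u = p].
have phiK u : phi (fl u) = u.
  by apply: xget_unique => //= v; exact: isometry_inj.
have [||psi [isopsi _ psiE]] := urysohn_ultrahomogeneous hU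
    (F := range (fl \o x)) (phi := phi).
- apply: finite_image; exact: finite_finset.
- by move=> _ _ [i _ <-] [j _ <-]; rewrite !phiK isofl.
exists (psi \o f \o inr); first by move=> u v; rewrite /= isopsi isof.
(* By the choice of [psi], [x i] equals [psi (fl (x i))], so the bridge of length [d] between [x i]
   and [y i] survives both isometries. *)
move=> i; rewrite -[x i]phiK -psiE; last by apply/mem_set; exists i.
rewrite /= isopsi isof metric_sym.
apply: (le_trans (cross_dist_le _ _ _ _ _ _ i)).
by rewrite !mdistxx add0r addr0.
Qed.

End glued_space.

(** * From precompactness to covers *)

Section diameter.
Context (R : realType) (X : metricType R).

Lemma diam_leP (A : set X) (r : R) :
  (diam A <= r%:E)%E <-> forall a b, A a -> A b -> mdist a b <= r.
Proof.
split=> [dA a b Aa Ab|dA].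
  by rewrite -lee_fin (le_trans _ dA)//; apply: ereal_sup_ubound; exists (a, b).
by apply: ge_ereal_sup => _ [[a b] /= [Aa Ab] <-]; rewrite lee_fin dA.
Qed.

Lemma seq_bounded (p : X) (s : seq X) :
  exists M : R, forall u, u \in s -> mdist p u <= M.
Proof.
elim: s => [|v s [M hM]]; first by exists 0.
exists (Num.max (mdist p v) M) => u; rewrite inE le_max.
by move=> /predU1P[->|/hM ->]; rewrite ?lexx ?orbT.
Qed.

End diameter.

Section precompact_to_uniform_cover.
Context (R : realType) (U : completeMetricType R).

(** Mass that starts in [C] either arrives in [C'] or travels at least [r]. *)
Lemma coupling_thicken (mu nu : borel_prob R U) pi (r : R)
    (C C' : set (borel U)) : couplings mu nu pi -> measurable C ->
  measurable C' -> (forall u v : U, C u -> mdist u v < r -> C' v) ->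
  (mu C <= nu C' + pi [set z | (r <= mdist z.1 z.2)%R])%E.
Proof.
move=> cpi mC mC' CC'; have [<- _] := cpi _ mC; have [_ <-] := cpi _ mC'.
have mP (f : U * U -> U) B : continuous f -> measurable (B : set (borel U)) ->
    measurable (f @^-1` B : set (borel (U * U)%type)).
  by move=> cf mB; rewrite -[X in measurable X]setTI; exact: continuous_borel.
have m1 : measurable (fst @^-1` C : set (borel (U * U)%type)).
  by apply: mP => // p; exact: cvg_fst.
have m2 : measurable (snd @^-1` C' : set (borel (U * U)%type)).
  by apply: mP => // p; exact: cvg_snd.
have m3 := @mdist_ge_borel R U r.
apply: (@le_trans _ _ (pi (snd @^-1` C' `|` [set z | r <= mdist z.1 z.2]))).
  apply: le_measure; rewrite ?inE//; first exact: measurableU.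
  move=> [u v] /= Cu; have [uv|uv] := ltP (mdist u v) r; last by right.
  by left; exact: CC' uv.
exact: measureU2.
Qed.

Lemma precompact_uniform_cover (K : set (prob_sim U)) : separable U ->
  totally_bounded (@W_H R U) K -> forall e : R, 0 < e ->
  exists (N : nat) (x : 'I_N -> U), (diam (range x) <= N%:R%:E)%E /\
    forall theta : prob_sim U, K theta ->
      exists2 mu : borel_prob R U, sval theta mu &
        ((1 - e)%:E < mu (\bigcup_i ball (x i) e))%E.
Proof.
(* [r <= 1] is needed for Markov's inequality, and [r <= e / 2] lets balls of radius [e / 2] grow to
   radius [e]. With net radius [r * (e / 2)], at most [e / 2] of the mass travels [r] or more. *)
move=> sU tb e e0; pose r := Num.min (e / 2) 1.
have e20 : 0 < e / 2 by lra.
have r0 : 0 < r by rewrite lt_min e20/=.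
have /tb[F finF KF] : 0 < r * (e / 2) by rewrite mulr_gt0.
have /finite_seqP[L FL] : finite_set (F : set {classic prob_sim U}) by [].
have /choice[S hS] (theta : prob_sim U) : exists s : seq U,
    exists2 mu, sval theta mu &
      ((1 - e / 2)%:E < mu (\bigcup_(x in [set` s]) ball x (e / 2)))%E.
  case: theta => C [mu E]; subst C.
  have [s hs] := finite_cover mu sU e20 e20.
  by exists s, mu => //=; exact: spt_iso_refl.
pose s := flatten [seq S theta | theta <- L].
have [M hM] := seq_bounded point (point :: s).
(* The same [N] counts the points and bounds their diameter. Indices from [size s] on give the
   default [point], which is why [M] bounds the distances for [point] as well. *)
pose N := (size s + Num.truncn (2 * M)).+1.
pose x (i : 'I_N) := nth point s i.
exists N, x; split.
  apply/diam_leP => _ _ [i _ <-] [j _ <-].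
  have xM k : mdist point (x k) <= M.
    apply: hM; rewrite inE /x; have [ks|ks] := ltnP k (size s).
      by rewrite mem_nth ?orbT.
    by rewrite nth_default// eqxx.
  have := xM i; have := xM j; have := metric_triangle (x i) point (x j).
  have : (Num.truncn (2 * M)).+1%:R <= N%:R :> R.
    by rewrite ler_nat /N ltnS leq_addl.
  by have := truncnS_gt (2 * M); rewrite (metric_sym (x i) point); lra.
move=> theta /KF[y Fy yt].
have [mu ymu hmu] := hS y.
have : (ereal_inf [set W mu nu | nu in sval theta] < (r * (e / 2))%:E)%E.
  apply: le_lt_trans yt; rewrite le_max; apply/orP; left.
  by apply: ereal_sup_ubound; exists mu.
move=> /ereal_inf_lt[_ [nu tnu <-] /transport_markov[]].
  by rewrite r0 ge_min lexx orbT.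
move=> pi cpi hpi; exists nu => //.
have := @coupling_thicken mu nu pi r
  (\bigcup_(x in [set` S y]) ball x (e / 2)) (\bigcup_i ball (x i) e) cpi
  (bigcup_mball_borel _ _ _) (bigcup_mball_borel _ _ _).
move=> h; have {h} : (mu (\bigcup_(x in [set` S y]) ball x (e / 2)) <=
    nu (\bigcup_i ball (x i) e) + pi [set z | (r <= mdist z.1 z.2)%R])%E.
  apply: h => u v [p /= pS /ballP pu] uv.
  have ps : p \in s.
    apply/flattenP; exists (S y) => //.
    apply: (@map_f {classic prob_sim U} _ S).
    by move: Fy; rewrite FL.
  have pN : (index p s < N)%N.
    by rewrite ltnS (leq_trans (index_size _ _))// leq_addr.
  exists (Ordinal pN) => //; apply/ballP; rewrite /x/= nth_index//.
  have := metric_triangle p u v.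
  by move: uv; rewrite lt_min => /andP[uv _]; lra.
rewrite -(@fineK _ (nu _)) ?fin_num_measure//; last exact: bigcup_mball_borel.
move=> h; have := lt_le_trans hmu (le_trans h (leeD2l _ (ltW hpi))).
by rewrite -EFinD !lte_fin; lra.
Qed.

End precompact_to_uniform_cover.

Lemma spt_nonempty (R : realType) (U : completeMetricType R)
  (mu : borel_prob R U) : separable U -> spt mu !=set0.
Proof.
move=> sU; apply/set0P/eqP => mu0.
have := @spt_full _ _ mu setT sU measurableT.
rewrite mu0 set0I measure0 probability_setT => /eqP.
by rewrite eq_sym onee_eq0.
Qed.

(** A centre whose ball of radius [e / 2] meets the support is replaced by a support point in that
    ball, at the price of doubling the radius; the other balls carry no mass. The isomorphism of
    supports then moves the points from [nu] to [mu]. *)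
Lemma uniform_cover_spt (R : realType) (U : completeMetricType R)
    (K : set (prob_sim U)) : separable U ->
  (forall e : R, 0 < e ->
    exists (N : nat) (x : 'I_N -> U), (diam (range x) <= N%:R%:E)%E /\
      forall theta : prob_sim U, K theta ->
        exists2 mu : borel_prob R U, sval theta mu &
          ((1 - e)%:E < mu (\bigcup_i ball (x i) e))%E) ->
  forall e : R, 0 < e ->
    exists N : nat, forall mu : borel_prob R U, K (prob_class mu) ->
      exists x : 'I_N -> U,
        [/\ forall i, spt mu (x i),
            ((1 - e)%:E < mu (\bigcup_i ball (x i) e))%E &
            (diam (range x) <= N%:R%:E)%E].
Proof.
move=> sU cov e e0; have e20 : 0 < e / 2 by lra.
have [N [x [/diam_leP dx hx]]] := cov _ e20.
(* Each new point is within [e / 2] of an old one, so the diameter grows by at most [e]. The bound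
   is also the number of points, hence the surplus indices, which are filled with [q]. *)
exists (N + (Num.truncn e).+1)%N => mu /hx[nu /= munu hnu].
pose meets i := exists2 u, spt nu u & mdist (x i) u < e / 2.
(* q takes the place of the points for which the ball misses the support. *)
have [q nuq qx] : exists2 q, spt nu q &
    (exists i, mdist (x i) q < e / 2) \/ forall i, ~ meets i.
  have [[i [q nuq xq]]|nomeet] := pselect (exists i, meets i).
    by exists q => //; left; exists i.
  have [q nuq] := spt_nonempty nu sU.
  by exists q => //; right => i mi; apply: nomeet; exists i.
have /choice[Y hY] (j : 'I_(N + (Num.truncn e).+1)) : exists y : U,
    [/\ spt nu y, forall i : 'I_N, i = j :> nat -> meets i ->
          mdist (x i) y < e / 2 &
        y = q \/ exists i, mdist (x i) y < e / 2].
  have [jN|jN] := ltnP j N; last first.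
    exists q; split => //; last by left.
    by move=> i ij; have := ltn_ord i; rewrite ij ltnNge jN.
  have [[u nuu xu]|nomeet] := pselect (meets (Ordinal jN)).
    exists u; split => //; last by right; exists (Ordinal jN).
    by move=> i ij _; rewrite (_ : i = Ordinal jN)//; exact: val_inj.
  exists q; split => //; last by left.
  by move=> i ij; rewrite (_ : i = Ordinal jN)//; exact: val_inj.
have [phi [iphi [fphi _ _] muE]] := spt_iso_sym sU munu.
have nuY j : spt nu (Y j) by have [] := hY j.
exists (phi \o Y); split.
- by move=> j; exact: fphi.
- rewrite -muE; last exact: bigcup_mball_borel.
  apply: (@lt_le_trans _ _ (nu (\bigcup_i ball (x i) (e / 2)))).
    by apply: le_lt_trans hnu; rewrite lee_fin; lra.
  have mC := @bigcup_mball_borel R U.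
  rewrite -spt_full//; apply: le_measure; rewrite ?inE.
  + by apply: measurableI => //; exact: spt_borel.
  + by apply: isometry_on_borel => //; exact: spt_closed.
  + move=> u [nuu [i _ /ballP xu]]; split => //.
    exists (lshift _ i) => //; apply/ballP; rewrite /= iphi//.
    have [_ /(_ i erefl) xY _] := hY (lshift _ i).
    have {}xY := xY (ex_intro2 _ _ u nuu xu).
    have := metric_triangle (Y (lshift _ i)) (x i) u.
    by rewrite (metric_sym _ (x i)); lra.
- apply/diam_leP => _ _ [j _ <-] [k _ <-]; rewrite /= iphi//.
  have [[i xq]|nomeet] := qx.
    have close j' : exists i, mdist (x i) (Y j') < e / 2.
      by have [_ _ [->|//]] := hY j'; exists i.
    have [[a xa] [b xb]] := (close j, close k).
    have := dx _ _ (imageT x a) (imageT x b).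
    have := metric_triangle (Y j) (x a) (Y k).
    have := metric_triangle (x a) (x b) (Y k).
    by have := truncnS_gt e; rewrite natrD (metric_sym _ (x a)); lra.
  (* Here no ball meets the support, which the mass bound permits only for [e > 2]; the new tuple is
     constant. *)
  have Yq j' : Y j' = q.
    have [_ _ [//|[i xY]]] := hY j'.
    by exfalso; apply: (nomeet i); exists (Y j').
  by rewrite !Yq mdistxx.
Qed.

(** * From covers to precompactness *)

Section cells.
Context (R : realType) (U : completeMetricType R) (N : nat).
Implicit Types (x : 'I_N -> U) (e : R).

Definition cell x e (i : 'I_N) : set (borel U) :=
  ball (x i) e `\` \bigcup_(j in [set j : 'I_N | (j < i)%N]) ball (x j) e.

Lemma cell_borel x e i : measurable (cell x e i).
Proof.
by apply: measurableD; [exact: mball_borel|exact: bigcup_mball_borel].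
Qed.

Lemma cell_mdist x e i (u : U) : cell x e i u -> mdist (x i) u < e.
Proof. by move=> [/ballP]. Qed.

Lemma cell_trivIset x e : trivIset setT (cell x e).
Proof.
move=> i j _ _ [u [[xi ni] [xj nj]]]; apply: val_inj => /=.
by case: (ltngtP i j) => // ij; exfalso; [apply: nj|apply: ni];
  [exists i|exists j].
Qed.

(** A point lies in the cell of the least index whose ball contains it. *)
Lemma bigcup_cell x e : \bigcup_i cell x e i = \bigcup_i ball (x i) e.
Proof.
apply/seteqP; split => u [i0 _ xu]; first by exists i0 => //; case: xu.
case: (@arg_minnP _ i0 (fun i => `[< ball (x i) e u >]) (@nat_of_ord N)).
  exact/asboolP.
move=> i /asboolP xi imin; exists i => //; split => // -[j /= ji /asboolP xj].
by have := imin j xj; rewrite leqNgt ji.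
Qed.

Lemma measure_bigcup_ball (mu : borel_prob R U) x e :
  mu (\bigcup_i ball (x i) e) = (\sum_i mu (cell x e i))%E.
Proof.
rewrite -bigcup_cell.
rewrite (measure_partition mu (cell_borel x e) (cell_trivIset (e := e)));
  last first.
  by rewrite bigcup_cell; exact: bigcup_mball_borel.
rewrite setICl measure0 add0e; apply: eq_bigr => i _; congr (mu _).
by apply/seteqP; split => [u []//|u xu]; split => //; exists i.
Qed.

End cells.

(** * Measures and tuples that show a given pattern of masses and distances *)

Section fits.
Context (R : realType) (U : completeMetricType R) (N : nat).
Implicit Types (x z : 'I_N -> U) (mu nu : borel_prob R U) (e : R).

(* c i and D k l stand for rounded values of the masses and distances. *)
Definition fits (e : R) (c : 'I_N -> R) (D : 'I_N -> 'I_N -> R) mu x :=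
  (forall i, ((c i)%:E <= mu (cell x e i))%E) /\
  (forall k l, `|mdist (x k) (x l) - D k l| <= e).

(** The cells are disjoint. This leaves a nonnegative remainder for the atom at [w] in
    [atomic_exists]. *)
Lemma fits_sum_le1 e c D mu x : fits e c D mu x -> \sum_i c i <= 1.
Proof.
move=> [cx _]; rewrite -lee_fin -sumEFin.
apply: (@le_trans _ _ (\sum_i mu (cell x e i))%E).
  by apply: lee_sum => i _; exact: cx.
rewrite -measure_bigcup_ball; apply: probability_le1.
exact: bigcup_mball_borel.
Qed.

(** On [S], the cells of [x] and those of [phi \o x] correspond. Both [S = setT], for global
    isometries, and [S = spt mu], for isomorphisms of supports, are needed. *)
Lemma fits_transport e c D mu nu x (S : set U) (phi : U -> U) :
  isometry_on S phi -> (forall i, S (x i)) ->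
  (forall A : set (borel U), measurable A -> mu (S `&` A) = mu A) ->
  (forall A : set (borel U), measurable A -> mu (S `&` phi @^-1` A) = nu A) ->
  fits e c D mu x -> fits e c D nu (phi \o x).
Proof.
move=> iphi Sx muS muphi [cx Dx]; split; last first.
  by move=> k l; rewrite /= iphi//; exact: Dx.
move=> i; apply: (le_trans (cx i)).
rewrite -muphi; last exact: cell_borel.
rewrite -muS; last exact: cell_borel.
rewrite (_ : S `&` cell x e i = S `&` phi @^-1` cell (phi \o x) e i)//.
have ballE u j : S u -> ball (phi (x j)) e (phi u) <-> ball (x j) e u.
  by move=> Su; split=> /ballP h; apply/ballP; rewrite ?iphi// in h *.
apply/seteqP; split => u [Su [xu nu']]; split => //; split.
- exact/ballE.
- by move=> [j ji /= xj]; apply: nu'; exists j => //; apply/ballE.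
- exact/ballE.
- by move=> [j ji /= xj]; apply: nu'; exists j => //; apply/ballE.
Qed.

Lemma fits_align e c D mu nu x z : fits e c D mu x -> fits e c D nu z ->
  almost_isometric e x z.
Proof.
move=> [_ Dx] [_ Dz] k l; have := Dx k l; have := Dz k l.
by rewrite !ler_norml => /andP[? ?] /andP[? ?]; apply/andP; split; lra.
Qed.

(** Both [z i] and the points of the [i]-th cell are within [e] of [x i], hence the term [2 * e];
    the remaining mass costs at most 1 per unit. *)
Lemma W_fits e c D mu nu x z w : 0 < e -> (forall i, 0 <= c i) ->
  fits e c D mu x -> (forall i, mdist (z i) (x i) <= e) ->
  atomic nu z c w -> (W nu mu <= (2 * e + (1 - \sum_i c i))%:E)%E.
Proof.
move=> e0 c0 [cx _] zx nuE.
have [|||pi cpi hpi] := @atomic_coupling R U _ mu nu (cell x e) z c w (2 * e)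
    _ _ c0 cx _ nuE.
- move=> i; exact: cell_borel.
- exact: cell_trivIset.
- move=> i u /cell_mdist xu; have := zx i.
  by have := metric_triangle (z i) (x i) u; lra.
by apply: transport_le cpi hpi; lra.
Qed.

End fits.

Lemma atomic_isometry (R : realType) (U : completeMetricType R) (I : finType)
    (nu : borel_prob R U) (z : I -> U) c w (f : U -> U) (nu' : borel_prob R U) :
  (forall A : set (borel U), measurable A -> nu' A = nu (f @^-1` A)) ->
  (forall A : set (borel U), measurable A ->
    measurable (f @^-1` A : set (borel U))) ->
  atomic nu z c w -> atomic nu' (f \o z) c (f w).
Proof. by move=> nu'E mf nuE B mB; rewrite nu'E// nuE//; exact: mf. Qed.

(* The given isomorphism is isometric only on spt nu; that set is finite, so
   ultrahomogeneity provides a global isometry that agrees with it there. *)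
Lemma atomic_spt_iso (R : realType) (U : completeMetricType R) (hU : urysohn U)
    (I : finType) (nu nu' : borel_prob R U) (z : I -> U) c w :
  atomic nu z c w -> spt_iso nu nu' ->
  exists2 f : U -> U, isometry f & atomic nu' (f \o z) c (f w).
Proof.
move=> nuE [phi [iphi _ nu'E]].
pose F := range z `|` [set w].
have finF : finite_set F.
  rewrite finite_setU; split => //; apply: finite_image; exact: finite_finset.
have cF : closed F.
  apply: (accessible_finite_set_closed (T := U)).1 => //.
  by apply: hausdorff_accessible; exact: metric_hausdorff.
have nuF (A : set (borel U)) : measurable A -> nu (F `&` A) = nu A.
  move=> mA; rewrite nuE; last by apply: measurableI => //; exact: closed_borel.
  rewrite nuE//; congr (_ + _)%:E.
    apply: eq_bigr => i _; rewrite !indicE in_setI (_ : z i \in F)//.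
    by rewrite inE; left; exists i.
  by rewrite !indicE in_setI (_ : w \in F)// inE; right.
have [|x y [_ mx] [_ my]|psi [isopsi _ psiE]] := urysohn_ultrahomogeneous hU
    (F := F `&` spt nu) (phi := phi).
- exact: finite_setIl.
- exact: iphi.
exists psi => //; apply: (@atomic_isometry _ _ _ nu) => //; last first.
  by move=> A mA; exact: isometry_borel.
have sU := urysohn_separable hU.
move=> A mA; rewrite -nu'E//.
have m1 : measurable (spt nu `&` phi @^-1` A : set (borel U)).
  by apply: isometry_on_borel => //; exact: spt_closed.
have m2 : measurable (psi @^-1` A : set (borel U)) by exact: isometry_borel.
(* Both sides are cut down to [F] and [spt nu], which carry all the mass and on whose intersection
   [psi] agrees with [phi]. *)
rewrite -nuF// -[RHS](spt_full _ sU)// -[RHS]nuF; last first.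
  by apply: measurableI => //; exact: spt_borel.
rewrite !setIA; congr (nu _); apply/seteqP.
by split => u /= [Fu]; rewrite psiE ?inE.
Qed.

Section net.
Context (R : realType) (U : completeMetricType R) (hU : urysohn U) (N : nat).

(** In each half one measure is given and the other may be chosen within its class, so it is moved
    by an aligning isometry before [W_fits] is applied. The bound is [2 * e] for the distances plus
    [2 * e] for the missing mass. *)
Lemma W_H_atomic (e : R) (c : 'I_N -> R) D (mu0 mu nu : borel_prob R U) x0 x w :
  0 < e -> (forall i, 0 <= c i) -> 1 - 2 * e < \sum_i c i -> 2 * e <= 1 ->
  (forall i, spt mu (x i)) ->
  fits e c D mu0 x0 -> fits e c D mu x -> atomic nu x0 c w ->
  (W_H (prob_class nu) (prob_class mu) <= (4 * e)%:E)%E.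
Proof.
move=> e0 c0 c1 e1 mux fx0 fx nuE; have sU := urysohn_separable hU.
(* Without indices the sum would be 0, against the lower bound on it and [2 * e <= 1]. *)
have [k0] : exists k0 : 'I_N, True.
  apply: contrapT => /forallNP noI; move: c1.
  rewrite big1 => [|i _]; last by case: (noI i).
  by rewrite subr_lt0 ltNge e1.
move=> _; rewrite ge_max; apply/andP; split.
(* The atomic measure [nu'] is given; [mu] is moved towards it. *)
- apply: ge_ereal_sup => _ [nu' nunu' <-].
  have [psi isopsi nu'E] := atomic_spt_iso hU nuE nunu'.
  have xE : almost_isometric e (psi \o x0) x.
    by move=> k l; rewrite /= isopsi; exact: (fits_align fx0 fx).
  have [g isog gx] := urysohn_align hU k0 e0 xE.
  apply: (@le_trans _ _ (W nu' (isometry_pushforward isog mu))).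
    apply: ereal_inf_lbound; exists (isometry_pushforward isog mu) => //.
    exact: spt_iso_pushforward.
  have fgx : fits e c D (isometry_pushforward isog mu) (g \o x).
    apply: (@fits_transport _ _ _ e c D mu _ x setT) => //.
    - by move=> A _; rewrite setTI.
    - by move=> A _; rewrite setTI.
  apply: (le_trans (W_fits e0 c0 fgx _ nu'E)).
    by move=> i; rewrite metric_sym; exact: gx.
  by rewrite lee_fin; lra.
(* Now [mu'] is given, and the atomic measure is moved. *)
- apply: ge_ereal_sup => _ [mu' mumu' <-].
  have [phi [iphi [fphi _ _] mu'E]] := mumu'.
  have fpx : fits e c D mu' (phi \o x).
    apply: (@fits_transport _ _ _ e c D mu _ x (spt mu)) => //.
    by move=> A mA; exact: spt_full.
  have [g isog gx] := urysohn_align hU k0 e0 (fits_align fpx fx0).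
  pose nu' := isometry_pushforward isog nu.
  apply: (@le_trans _ _ (W nu' mu')).
    apply: ereal_inf_lbound; exists nu' => //.
    exact: spt_iso_pushforward.
  have nu'E : atomic nu' (g \o x0) c (g w).
    apply: atomic_isometry nuE => //.
    by move=> A mA; exact: isometry_borel.
  apply: (le_trans (W_fits e0 c0 fpx _ nu'E)) => //.
  by rewrite lee_fin; lra.
Qed.

End net.

(** Taking the multiple in an ordinal type makes the set of possible roundings finite. *)
Lemma round_down (R : realType) (h M x : R) : 0 < h -> 0 <= x <= M ->
  exists a : 'I_(Num.truncn (M / h)).+1, a%:R * h <= x < a%:R * h + h.
Proof.
move=> h0 /andP[x0 xM].
have aM : (Num.truncn (x / h) < (Num.truncn (M / h)).+1)%N.
  by rewrite ltnS le_truncn// ler_pM2r// invr_gt0.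
exists (Ordinal aM) => /=.
have /truncn_itv : 0 <= x / h by rewrite divr_ge0// ltW.
by rewrite ler_pdivlMr// ltr_pdivrMr// -natr1 mulrDl mul1r.
Qed.

Lemma uniform_cover_precompact (R : realType) (U : completeMetricType R)
    (hU : urysohn U) (K : set (prob_sim U)) :
  (forall e : R, 0 < e ->
    exists N : nat, forall mu : borel_prob R U, K (prob_class mu) ->
      exists x : 'I_N -> U,
        [/\ forall i, spt mu (x i),
            ((1 - e)%:E < mu (\bigcup_i ball (x i) e))%E &
            (diam (range x) <= N%:R%:E)%E]) ->
  totally_bounded (@W_H R U) K.
Proof.
(* The net is reached within [4 * e]; dividing by 8 makes this strictly smaller than [e']. The bound
   [1 / 4] ensures [2 * e <= 1]. *)
move=> cov e' e'0; pose e := Num.min (e' / 8) (1 / 4).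
have e0 : 0 < e by rewrite lt_min; apply/andP; split; lra.
have ee' : 4 * e < e'.
  have : e <= e' / 8 by rewrite ge_min lexx.
  by lra.
have e1 : 2 * e <= 1.
  have : e <= 1 / 4 by rewrite ge_min lexx orbT.
  by lra.
have [N hN] := cov e e0.
(* Rounding [N] masses down in steps of [h] loses at most [e] in total, so more than [1 - 2 * e]
   remains. The successor avoids division by zero. *)
pose h := e / N.+1%:R.
have h0 : 0 < h by rewrite divr_gt0.
pose pattern : finType := ({ffun 'I_N -> 'I_(Num.truncn (1 / h)).+1} *
  {ffun 'I_N * 'I_N -> 'I_(Num.truncn (N%:R / e)).+1})%type.
pose c (p : pattern) i : R := (p.1 i)%:R * h.
pose D (p : pattern) k l : R := (p.2 (k, l))%:R * e.
have c0 p i : 0 <= c p i by rewrite mulr_ge0// ltW.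
have /choice[y hy] (p : pattern) : exists y : prob_sim U,
    forall mu x, (forall i, spt mu (x i)) -> 1 - 2 * e < \sum_i c p i ->
      fits e (c p) (D p) mu x -> (W_H y (prob_class mu) <= (4 * e)%:E)%E.
  have [[mu0 [x0 fx0]]|no] := pselect (exists (mu0 : borel_prob R U) x0,
      fits e (c p) (D p) mu0 x0).
    have [nu nuE] := atomic_exists x0 point (c0 p) (fits_sum_le1 fx0).
    exists (prob_class nu) => mu x mux c1 fx.
    by apply: (@W_H_atomic _ _ hU _ e (c p) (D p) mu0 mu nu x0 x point).
  (* No measure shows this pattern, so any class will do. *)
  exists (prob_class (dirac (point : borel U))) => mu x _ _ fx.
  by exfalso; apply: no; exists mu, x.
exists (range y); first by apply: finite_image; exact: finite_finset.
move=> theta Kt.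
have [mu tE] : exists mu, theta = prob_class mu.
  by case: theta {Kt} => C [mu E]; subst C; exists mu.
move: Kt; rewrite tE => /hN[x [mux hmu /diam_leP dx]].
pose m i : R := fine (mu (cell x e i)).
have mE i : mu (cell x e i) = (m i)%:E.
  by rewrite fineK// fin_num_measure//; exact: cell_borel.
have /choice[a ha] (i : 'I_N) :
    exists a : 'I_(Num.truncn (1 / h)).+1, a%:R * h <= m i < a%:R * h + h.
  apply: round_down => //; rewrite -!lee_fin -mE measure_ge0/=.
  by apply: probability_le1; exact: cell_borel.
have /choice[b hb] (kl : 'I_N * 'I_N) :
    exists b : 'I_(Num.truncn (N%:R / e)).+1,
    b%:R * e <= mdist (x kl.1) (x kl.2) < b%:R * e + e.
  by apply: round_down => //; rewrite mdist_ge0/= dx.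
pose p : pattern := ([ffun i => a i], [ffun kl => b kl]).
exists (y p); first by exists p.
rewrite /=; apply: (@le_lt_trans _ _ (4 * e)%:E); last by rewrite lte_fin.
apply: (hy p mu x) => //.
  have : 1 - e < \sum_i m i.
    rewrite -lte_fin (lt_le_trans hmu)// measure_bigcup_ball -sumEFin.
    by apply: lee_sum => i _; rewrite mE.
  have : \sum_i m i <= \sum_(i < N) (c p i + h).
    by apply: ler_sum => i _; rewrite /c ffunE; have /andP[_ /ltW] := ha i.
  rewrite big_split/= sumr_const card_ord -mulr_natr.
  have : h * N%:R <= e.
    by rewrite /h -mulrA ler_piMr ?ltW// mulrC ltr_pdivrMr// mul1r ltr_nat.
  by lra.
split=> [i|k l].
  by rewrite mE lee_fin /c ffunE; have /andP[] := ha i.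
rewrite /D ffunE ler_norml; have /andP[? ?] := hb (k, l).
by apply/andP; split; lra.
Qed.

Theorem theorem4p5 (R : realType) (U : completeMetricType R) (hU : urysohn U)
    (K : set (prob_sim U)) :
  [<-> totally_bounded (@W_H R U) K;
       totally_bounded (@d_mG R U hU) (Phi hU @^-1` K);
       forall e : R, 0 < e ->
         exists (N : nat) (x : 'I_N -> U),
           (diam (range x) <= N%:R%:E)%E /\
           forall theta : prob_sim U, K theta ->
             exists2 mu : borel_prob R U, sval theta mu &
               ((1 - e)%:E < mu (\bigcup_i ball (x i) e))%E;
       forall e : R, 0 < e ->
         exists N : nat, forall mu : borel_prob R U, K (prob_class mu) ->
           exists x : 'I_N -> U,
             [/\ forall i, spt mu (x i),
                 ((1 - e)%:E < mu (\bigcup_i ball (x i) e))%E &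
                 (diam (range x) <= N%:R%:E)%E]].
Proof.
have sU := urysohn_separable hU.
tfae.
- by move/(totally_bounded_Phi sU hU).
- by move/(totally_bounded_Phi sU hU); exact: precompact_uniform_cover.
- exact: uniform_cover_spt.
- exact: uniform_cover_precompact.
Qed.
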